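(* Let $M=S^2(-\frac{q_1}{p_1},-\frac{q_2}{p_2},\frac{q_3}{p_3})$ be a small Seifert manifold, with $\pi_1(M)=\langle h,c_1,c_2\mid hc_1=c_1h,\ hc_2=c_2h,\ c_i^{p_i}=h^{q_i}\ (i=1,2,3)\rangle$ where $c_3:=c_1c_2$. Set $u=t_h$, $x_i=t_{c_i}$, $y_i=t_{hc_i}$ ($i=1,2,3$). Then $\mathbb{C}[{\mathcal{X}}(M)]$ is isomorphic (via the map sending the variables to these elements) to the quotient of $\mathbb{C}[u,x_1,x_2,x_3,y_1,y_2,y_3]$ by the ideal generated by: (1) $u^2+x_i^2+y_i^2-ux_iy_i-4$, $i=1,2,3$; (2) $2y_i-(ux_i+x_jy_3-x_3y_j)$, $\{i,j\}=\{1,2\}$; (3) $2y_3-(u(x_3-x_1x_2)+y_1x_2+y_2x_1)$; (4) $2x_3-(uy_3+x_1x_2-y_1y_2)$; (5) $T_{q_i}(u)-T_{p_i}(x_i)$, $i=1,2,3$; (6) $T_{q_i+1}(u)-S_{p_i}(x_i)y_i+S_{p_i-1}(x_i)u$, $i=1,2,3$; (7) $S_{q_i}(u)y_i-S_{q_i-1}(u)x_i-T_{p_i+1}(x_i)$, $i=1,2,3$; (8) $S_{q_i}(u)y_j-S_{q_i-1}(u)x_j-S_{p_i}(x_i)x_3+S_{p_i-1}(x_i)x_j$, $\{i,j\}=\{1,2\}$; (9) $S_{q_i+1}(u)y_i-S_{q_i}(u)x_i-S_{p_i+1}(x_i)y_i+S_{p_i}(x_i)u$, $i=1,2,3$; (10)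 $S_{q_i}(u)y_k-S_{q_i-1}(u)x_k-S_{p_i+1}(x_i)x_k+S_{p_i}(x_i)x_j$, for $i,j,k$ pairwise distinct in $\{1,2,3\}$ with $j\neq3$; (11) $S_{q_i+1}(u)y_j-S_{q_i}(u)x_j-S_{p_i}(x_i)y_3+S_{p_i-1}(x_i)y_j$, $\{i,j\}=\{1,2\}$; (12) $S_{q_3+1}(u)y_i-S_{q_3}(u)x_i-S_{p_3}(x_3)(x_iy_3-y_j)+S_{p_3-1}(x_3)y_i$, $\{i,j\}=\{1,2\}$.
   Context: Here $p_i\ge2$ and $q_i$ are integers with $\gcd(p_i,q_i)=1$. $\mathbb{C}[{\mathcal{X}}(M)]=\mathbb{C}[{\mathcal{X}}(\pi_1(M))]$ is the coordinate ring of the $\mathrm{SL}_2(\mathbb{C})$-character scheme; equivalently, the commutative $\mathbb{C}$-algebra generated by symbols $t_x$, $x\in\pi_1(M)$, subject to $t_{xy}+t_{xy^{-1}}=t_xt_y$, $t_{xy}=t_{yx}$ and $t_1=2$. The Chebyshev polynomials are $T_0=2$, $T_1=X$, $T_{n+1}=XT_n-T_{n-1}$, $S_0=0$, $S_1=1$, $S_{n+1}=XS_n-S_{n-1}$, extended to all integers $n$ by the recurrence ($T_{-n}=T_n$, $S_{-n}=-S_n$). *)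

(* Defs.v *)
From HB Require Import structures.
From mathcomp Require Import all_boot all_order all_algebra.
From mathcomp Require Import reals complex mpoly.

Set Implicit Arguments.
Unset Strict Implicit.
Unset Printing Implicit Defensive.

Import Order.TTheory GRing.Theory Num.Theory.
Local Open Scope ring_scope.

Fixpoint chebT_nat (R : pzRingType) (x : R) (n : nat) : R :=
  match n with
  | 0 => 2
  | 1 => x
  | (m.+1 as k).+1 => x * chebT_nat x k - chebT_nat x m
  end.

Fixpoint chebS_nat (R : pzRingType) (x : R) (n : nat) : R :=
  match n with
  | 0 => 0
  | 1 => 1
  | (m.+1 as k).+1 => x * chebS_nat x k - chebS_nat x m
  end.

Definition chebT (R : pzRingType) (n : int) (x : R) : R :=
  match n with Posz k => chebT_nat x k | Negz k => chebT_nat x k.+1 end.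

Definition chebS (R : pzRingType) (n : int) (x : R) : R :=
  match n with Posz k => chebS_nat x k | Negz k => - chebS_nat x k.+1 end.

(** * The group pi_1(M) = < h, c1, c2 | h c1 = c1 h, h c2 = c2 h, c_i^{p_i} = h^{q_i} >,
      c3 := c1 c2, presented by words in the free group on h (index 0), c1 (index 1),
      c2 (index 2).  A letter is (inverted?, generator). *)

Definition letter := (bool * 'I_3)%type.
Definition word := seq letter.

Definition flip (l : letter) : letter := (~~ l.1, l.2).
Definition winv (w : word) : word := rev (map flip w).
Definition wpow (w : word) (z : int) : word :=
  match z with
  | Posz n => flatten (nseq n w)
  | Negz n => flatten (nseq n.+1 (winv w))
  end.

Definition gen (k : nat) : word := [:: (false, inord k)].
Definition w_h : word := gen 0.
Definition w_c1 : word := gen 1.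
Definition w_c2 : word := gen 2.
Definition w_c3 : word := w_c1 ++ w_c2.

Definition relators (p1 p2 p3 : nat) (q1 q2 q3 : int) : seq word :=
  [:: w_h ++ w_c1 ++ winv w_h ++ winv w_c1;
      w_h ++ w_c2 ++ winv w_h ++ winv w_c2;
      wpow w_c1 p1%:Z ++ wpow w_h (- q1);
      wpow w_c2 p2%:Z ++ wpow w_h (- q2);
      wpow w_c3 p3%:Z ++ wpow w_h (- q3)].

(** A function on words descends to pi_1(M) iff it is invariant under the elementary
    moves (insertion of x x^{-1} or of a relator anywhere) generating the congruence. *)
Definition descends (A : Type) (p1 p2 p3 : nat) (q1 q2 q3 : int) (f : word -> A) : Prop :=
  forall w1 w2 : word,
    (forall l : letter, f (w1 ++ [:: l; flip l] ++ w2) = f (w1 ++ w2)) /\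
    (forall r, r \in relators p1 p2 p3 q1 q2 q3 -> f (w1 ++ r ++ w2) = f (w1 ++ w2)).

Definition trace_fun (A : comNzRingType) (p1 p2 p3 : nat) (q1 q2 q3 : int)
    (t : word -> A) : Prop :=
  descends p1 p2 p3 q1 q2 q3 t /\
  (forall x y : word, t (x ++ y) + t (x ++ winv y) = t x * t y) /\
  (forall x y : word, t (x ++ y) = t (y ++ x)) /\
  t [::] = 2.

(** (A, t) is the coordinate ring C[X(pi_1(M))]: the commutative C-algebra generated
    by the symbols t_x subject to the trace relations, i.e. (A, t) is universal among
    trace-like functions into commutative C-algebras. *)
Definition is_char_ring (C : fieldType) (p1 p2 p3 : nat) (q1 q2 q3 : int)
    (A : comAlgType C) (t : word -> A) : Prop :=
  trace_fun p1 p2 p3 q1 q2 q3 t /\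
  forall (B : comAlgType C) (tau : word -> B), trace_fun p1 p2 p3 q1 q2 q3 tau ->
    (exists f : {lrmorphism A -> B}, forall w, f (t w) = tau w) /\
    (forall f g : {lrmorphism A -> B},
        (forall w, f (t w) = tau w) -> (forall w, g (t w) = tau w) -> f =1 g).

Section Ideal.
Variable C : fieldType.
Variables (p1 p2 p3 : nat) (q1 q2 q3 : int).

Local Notation P := {mpoly C[7]}.

Definition vU : P := 'X_(inord 0).
Definition vX (i : nat) : P := 'X_(inord i).
Definition vY (i : nat) : P := 'X_(inord (i + 3)).
Definition pp (i : nat) : int := match i with 1 => p1%:Z | 2 => p2%:Z | _ => p3%:Z end.
Definition qq (i : nat) : int := match i with 1 => q1 | 2 => q2 | _ => q3 end.

Local Notation u := vU.
Local Notation x := vX.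
Local Notation y := vY.
Local Notation T := chebT.
Local Notation S := chebS.
Local Notation p := pp.
Local Notation q := qq.

Definition rel1 (i : nat) : P := u ^+ 2 + x i ^+ 2 + y i ^+ 2 - u * x i * y i - 4.
Definition rel2 (i j : nat) : P := 2 * y i - (u * x i + x j * y 3 - x 3 * y j).
Definition rel3 : P := 2 * y 3 - (u * (x 3 - x 1 * x 2) + y 1 * x 2 + y 2 * x 1).
Definition rel4 : P := 2 * x 3 - (u * y 3 + x 1 * x 2 - y 1 * y 2).
Definition rel5 (i : nat) : P := T (q i) u - T (p i) (x i).
Definition rel6 (i : nat) : P :=
  T (q i + 1) u - S (p i) (x i) * y i + S (p i - 1) (x i) * u.
Definition rel7 (i : nat) : P :=
  S (q i) u * y i - S (q i - 1) u * x i - T (p i + 1) (x i).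
Definition rel8 (i j : nat) : P :=
  S (q i) u * y j - S (q i - 1) u * x j - S (p i) (x i) * x 3 + S (p i - 1) (x i) * x j.
Definition rel9 (i : nat) : P :=
  S (q i + 1) u * y i - S (q i) u * x i - S (p i + 1) (x i) * y i + S (p i) (x i) * u.
Definition rel10 (i j k : nat) : P :=
  S (q i) u * y k - S (q i - 1) u * x k - S (p i + 1) (x i) * x k + S (p i) (x i) * x j.
Definition rel11 (i j : nat) : P :=
  S (q i + 1) u * y j - S (q i) u * x j - S (p i) (x i) * y 3 + S (p i - 1) (x i) * y j.
Definition rel12 (i j : nat) : P :=
  S (q 3 + 1) u * y i - S (q 3) u * x i - S (p 3) (x 3) * (x i * y 3 - y j)
  + S (p 3 - 1) (x 3) * y i.

Definition gens : seq P :=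
  [:: rel1 1; rel1 2; rel1 3;
      rel2 1 2; rel2 2 1;
      rel3;
      rel4;
      rel5 1; rel5 2; rel5 3;
      rel6 1; rel6 2; rel6 3;
      rel7 1; rel7 2; rel7 3;
      rel8 1 2; rel8 2 1;
      rel9 1; rel9 2; rel9 3;
      (* (i,j,k) pairwise distinct in {1,2,3} with j <> 3 *)
      rel10 1 2 3; rel10 2 1 3; rel10 3 1 2; rel10 3 2 1;
      rel11 1 2; rel11 2 1;
      rel12 1 2; rel12 2 1].

Definition in_ideal_gen (g : seq P) (f : P) : Prop :=
  exists c : seq P, size c = size g /\ f = \sum_(k < size g) c`_k * g`_k.

End Ideal.

Definition var_word (k : 'I_7) : word :=
  match val k with
  | 0 => w_h
  | 1 => w_c1
  | 2 => w_c2
  | 3 => w_c3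
  | 4 => w_h ++ w_c1
  | 5 => w_h ++ w_c2
  | _ => w_h ++ w_c3
  end.

(* Main.v *)
(** Let E be the algebra of rank 8 over a ring Q containing parameters u, x_i, y_i,
    with basis 1, c1, c2, c3 = c1 c2, h, h c1, h c2, h c3 and relations
    h^2 = u h - 1, h central, c_i^2 = x_i c_i - 1; it receives every word in the
    generators.  Let l be the linear form with values 2, x_i, u, y_i on this basis.
    Symmetry l(ab) = l(ba) and the identity l(a(b + b')) = l(a) l(b), b' the conjugate of b, are bilinear, so
    they amount to finitely many equations, and relations (1)-(4) imply them.  Since
    c^p = S_p c - S_(p-1), relations (5)-(12) say that
    l(c_i^(p_i) v) = l(h^(q_i) v) for v in the basis.  Hence l is a trace function with
    values in the quotient by the ideal.  Conversely every trace function t of the group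
    equals l on words (with u = t_h, ...), so its values satisfy the relations and are
    polynomials in the seven variables.  Universality then gives mutually inverse maps. *)

Require Import Defs.
From HB Require Import structures.
From mathcomp Require Import all_boot all_order all_algebra.
From mathcomp Require Import reals complex mpoly.
From mathcomp Require Import boolp generic_quotient ring_quotient ring zify.

Set Implicit Arguments.
Unset Strict Implicit.
Unset Printing Implicit Defensive.

Import Order.TTheory GRing.Theory Num.Theory.
Local Open Scope ring_scope.

(** * Words *)

Lemma flipK l : flip (flip l) = l.
Proof. by case: l => [[] g]. Qed.

Lemma winv_cat v w : winv (v ++ w) = winv w ++ winv v.
Proof. by rewrite /winv map_cat rev_cat. Qed.

Lemma winvK w : winv (winv w) = w.
Proof.
rewrite /winv map_rev revK -map_comp -[RHS]map_id; apply: eq_map => l.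
exact: flipK.
Qed.

Lemma winv_nseq n w : winv (flatten (nseq n w)) = flatten (nseq n (winv w)).
Proof.
elim: n => // n IH; rewrite [nseq n.+1 w]/= [flatten (w :: _)]/= winv_cat IH.
(* The extra block comes out last; this induction brings it to the front. *)
by elim: {IH} n => [|n IH] /=; rewrite ?cats0 // -catA IH.
Qed.

Lemma wpowN w z : wpow w (- z) = winv (wpow w z).
Proof.
case: z => [[|n]|n] //; rewrite [in RHS]/wpow winv_nseq ?winvK //.
Qed.

(** * The rank 8 algebra *)

(** Coordinates in the basis 1, c1, c2, c3, h, h c1, h c2, h c3. *)
Record oct (Q : Type) := Oct {
  k0 : Q; k1 : Q; k2 : Q; k3 : Q; l0 : Q; l1 : Q; l2 : Q; l3 : Q }.

Section Oct.
Variables (Q : comNzRingType) (u x1 x2 x3 : Q).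
Implicit Types a b c : oct Q.

Definition oone : oct Q := Oct 1 0 0 0 0 0 0 0.

(** Structure constants of the rank 4 subalgebra on 1, c1, c2, c3. The one product that is not
    immediate is c2 c1 = x3 - x1 x2 + x2 c1 + x1 c2 - c3, read off from c3^-1 = c2^-1 c1^-1 with
    g^-1 = t_g - g. *)
Local Notation m0 a0 a1 a2 a3 b0 b1 b2 b3 :=
  (a0 * b0 - a1 * b1 + (x3 - x1 * x2) * (a2 * b1) - a2 * b2
   - x1 * (a2 * b3) - x2 * (a3 * b1) - a3 * b3).
Local Notation m1 a0 a1 a2 a3 b0 b1 b2 b3 :=
  (a0 * b1 + a1 * b0 + x1 * (a1 * b1) + x2 * (a2 * b1) + a2 * b3
   + x3 * (a3 * b1) - a3 * b2).
Local Notation m2 a0 a1 a2 a3 b0 b1 b2 b3 :=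
  (a0 * b2 + a2 * b0 - a1 * b3 + x1 * (a2 * b1) + x2 * (a2 * b2)
   + x3 * (a2 * b3) + a3 * b1).
Local Notation m3 a0 a1 a2 a3 b0 b1 b2 b3 :=
  (a0 * b3 + a3 * b0 + a1 * b2 + x1 * (a1 * b3) - a2 * b1 + x2 * (a3 * b2)
   + x3 * (a3 * b3)).

Definition omul a b : oct Q :=
  let: Oct a0 a1 a2 a3 a4 a5 a6 a7 := a in
  let: Oct b0 b1 b2 b3 b4 b5 b6 b7 := b in
  Oct (m0 a0 a1 a2 a3 b0 b1 b2 b3 - m0 a4 a5 a6 a7 b4 b5 b6 b7)
      (m1 a0 a1 a2 a3 b0 b1 b2 b3 - m1 a4 a5 a6 a7 b4 b5 b6 b7)
      (m2 a0 a1 a2 a3 b0 b1 b2 b3 - m2 a4 a5 a6 a7 b4 b5 b6 b7)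
      (m3 a0 a1 a2 a3 b0 b1 b2 b3 - m3 a4 a5 a6 a7 b4 b5 b6 b7)
      (m0 a0 a1 a2 a3 b4 b5 b6 b7 + m0 a4 a5 a6 a7 b0 b1 b2 b3 + u * (m0 a4 a5 a6 a7 b4 b5 b6 b7))
      (m1 a0 a1 a2 a3 b4 b5 b6 b7 + m1 a4 a5 a6 a7 b0 b1 b2 b3 + u * (m1 a4 a5 a6 a7 b4 b5 b6 b7))
      (m2 a0 a1 a2 a3 b4 b5 b6 b7 + m2 a4 a5 a6 a7 b0 b1 b2 b3 + u * (m2 a4 a5 a6 a7 b4 b5 b6 b7))
      (m3 a0 a1 a2 a3 b4 b5 b6 b7 + m3 a4 a5 a6 a7 b0 b1 b2 b3 + u * (m3 a4 a5 a6 a7 b4 b5 b6 b7)).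

Lemma omulA a b c : omul a (omul b c) = omul (omul a b) c.
Proof.
case: a b c => [a0 a1 a2 a3 a4 a5 a6 a7] [b0 b1 b2 b3 b4 b5 b6 b7]
  [c0 c1 c2 c3 c4 c5 c6 c7].
by rewrite /omul; congr Oct; ring.
Qed.

Lemma omul1o a : omul oone a = a.
Proof. by case: a => * /=; congr Oct; ring. Qed.

Lemma omulo1 a : omul a oone = a.
Proof. by case: a => * /=; congr Oct; ring. Qed.

(** The linear anti-involution with c_i -> x_i - c_i and h -> u - h. It acts as inversion on images
    of words, because g^2 = t g - 1 gives g^-1 = t - g. *)
Definition ostar a : oct Q :=
  let: Oct a0 a1 a2 a3 a4 a5 a6 a7 := a in
  Oct (a0 + x1 * a1 + x2 * a2 + x3 * a3 + u * (a4 + x1 * a5 + x2 * a6 + x3 * a7))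
      (- a1 - u * a5) (- a2 - u * a6) (- a3 - u * a7)
      (- a4 - x1 * a5 - x2 * a6 - x3 * a7) a5 a6 a7.

Lemma ostarM a b : ostar (omul a b) = omul (ostar b) (ostar a).
Proof.
case: a b => [a0 a1 a2 a3 a4 a5 a6 a7] [b0 b1 b2 b3 b4 b5 b6 b7].
by rewrite /ostar /omul; congr Oct; ring.
Qed.

Lemma ostarK a : ostar (ostar a) = a.
Proof. by case: a => * /=; congr Oct; ring. Qed.

Local Arguments omul : simpl never.

Definition dot a b : Q :=
  let: Oct a0 a1 a2 a3 a4 a5 a6 a7 := a in
  let: Oct b0 b1 b2 b3 b4 b5 b6 b7 := b in
  a0 * b0 + a1 * b1 + a2 * b2 + a3 * b3 + a4 * b4 + a5 * b5 + a6 * b6 + a7 * b7.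

Definition oc1 : oct Q := Oct 0 1 0 0 0 0 0 0.
Definition oc2 : oct Q := Oct 0 0 1 0 0 0 0 0.
Definition oc3 : oct Q := Oct 0 0 0 1 0 0 0 0.
Definition oh : oct Q := Oct 0 0 0 0 1 0 0 0.
Definition ohc1 : oct Q := Oct 0 0 0 0 0 1 0 0.
Definition ohc2 : oct Q := Oct 0 0 0 0 0 0 1 0.
Definition ohc3 : oct Q := Oct 0 0 0 0 0 0 0 1.

Definition ogen (g : 'I_3) : oct Q :=
  match val g with 0 => oh | 1 => oc1 | _ => oc2 end.

Definition olet (l : letter) : oct Q :=
  if l.1 then ostar (ogen l.2) else ogen l.2.

(** Defined on words and not on the group: the equations c_i^(p_i) = h^(q_i) need not hold in the
    algebra, only under the trace form. *)
Definition rho (w : word) : oct Q := foldr (fun l a => omul (olet l) a) oone w.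

Lemma rho_cat w1 w2 : rho (w1 ++ w2) = omul (rho w1) (rho w2).
Proof.
elim: w1 => [|l w1 IH] /=; first by rewrite omul1o.
by rewrite IH omulA.
Qed.

Lemma rho_inv w : rho (winv w) = ostar (rho w).
Proof.
elim: w => [|l w IH]; first by rewrite /=; congr Oct; ring.
rewrite /winv map_cons rev_cons -cats1 rho_cat -/(winv w) IH /= ostarM omulo1.
by case: l => -[] g; rewrite /olet /= ?ostarK.
Qed.

Lemma olet_flip l : omul (olet l) (olet (flip l)) = oone.
Proof.
case: l => b g; rewrite /olet /ogen /flip /=.
by case: b; case: (val g) => [|[|k]]; rewrite /omul /=; congr Oct; ring.
Qed.

Lemma rho_mulV w : omul (rho w) (rho (winv w)) = oone.
Proof.
elim: w => [|l w IH]; first by rewrite /= omulo1.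
rewrite /winv map_cons rev_cons -cats1 rho_cat -/(winv w) /= -!omulA.
by rewrite (omulA (rho w)) IH omul1o omulo1 olet_flip.
Qed.

(** The sign is the one of c^p = S_p c - S_(p-1). *)
Definition ocomb s a r b : oct Q :=
  let: Oct a0 a1 a2 a3 a4 a5 a6 a7 := a in
  let: Oct b0 b1 b2 b3 b4 b5 b6 b7 := b in
  Oct (s * a0 - r * b0) (s * a1 - r * b1) (s * a2 - r * b2) (s * a3 - r * b3)
      (s * a4 - r * b4) (s * a5 - r * b5) (s * a6 - r * b6) (s * a7 - r * b7).

Lemma omul_comb a s b r c :
  omul a (ocomb s b r c) = ocomb s (omul a b) r (omul a c).
Proof.
case: a b c => [a0 a1 a2 a3 a4 a5 a6 a7] [b0 b1 b2 b3 b4 b5 b6 b7]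
  [c0 c1 c2 c3 c4 c5 c6 c7].
by rewrite /omul /=; congr Oct; ring.
Qed.

Lemma ostar_comb s a r b :
  ostar (ocomb s a r b) = ocomb s (ostar a) r (ostar b).
Proof. by case: a b => ? ? ? ? ? ? ? ? [*] /=; congr Oct; ring. Qed.

Lemma rho_pow_nat w x n : omul (rho w) (rho w) = ocomb x (rho w) 1 oone ->
  rho (flatten (nseq n.+1 w))
  = ocomb (chebS_nat x n.+1) (rho w) (chebS_nat x n) oone.
Proof.
move=> sq; elim: n => [|n IH].
  by rewrite /= cats0; case: (rho w) => * /=; congr Oct; ring.
have -> : flatten (nseq n.+2 w) = w ++ flatten (nseq n.+1 w) by [].
rewrite rho_cat {}IH omul_comb sq omulo1.
have -> : chebS_nat x n.+2 = x * chebS_nat x n.+1 - chebS_nat x n by [].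
by case: (rho w) => * /=; congr Oct; ring.
Qed.

(** For negative exponents, conjugation turns S_n c - S_(n-1) into S_n (x - c) - S_(n-1) = - S_n c +
    S_(n+1), and S is odd in its index. *)
Lemma rho_pow w x (z : int) : omul (rho w) (rho w) = ocomb x (rho w) 1 oone ->
  ostar (rho w) = ocomb (-1) (rho w) (- x) oone ->
  rho (wpow w z) = ocomb (chebS z x) (rho w) (chebS (z - 1) x) oone.
Proof.
move=> sq st; case: z => [[|n]|n].
- by rewrite /=; case: (rho w) => * /=; rewrite /oone; congr Oct; ring.
- by rewrite [wpow _ _]/= (rho_pow_nat _ sq) // (_ : (n.+1%:Z - 1 = n%:Z)%R) //; lia.
- have -> : wpow w (Negz n) = winv (flatten (nseq n.+1 w)) by rewrite winv_nseq.
  rewrite rho_inv (rho_pow_nat _ sq) // (_ : (Negz n - 1 : int) = Negz n.+1); last by lia.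
  have -> : chebS (Negz n.+1) x = - (x * chebS_nat x n.+1 - chebS_nat x n) by [].
  rewrite [chebS _ _]/= -/(chebS_nat x n.+1).
  rewrite ostar_comb st; move: (chebS_nat x n.+1) (chebS_nat x n) => s r.
  by case: (rho w) => * /=; congr Oct; ring.
Qed.

(** * The trace form *)

Section Trace.
Variables (y1 y2 y3 : Q).
Hypothesis two_inj : forall a : Q, 2 * a = 0 -> a = 0.

Definition otr a : Q := dot (Oct 2 x1 x2 x3 u y1 y2 y3) a.

Definition central_eqs : seq Q :=
  [:: u ^+ 2 + x1 ^+ 2 + y1 ^+ 2 - u * x1 * y1 - 4;
      u ^+ 2 + x2 ^+ 2 + y2 ^+ 2 - u * x2 * y2 - 4;
      u ^+ 2 + x3 ^+ 2 + y3 ^+ 2 - u * x3 * y3 - 4;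
      2 * y1 - (u * x1 + x2 * y3 - x3 * y2);
      2 * y2 - (u * x2 + x1 * y3 - x3 * y1);
      2 * y3 - (u * (x3 - x1 * x2) + y1 * x2 + y2 * x1);
      2 * x3 - (u * y3 + x1 * x2 - y1 * y2)].

Hypothesis central : all (eq_op^~ 0) central_eqs.

(** The default value 0 makes [r_ i = 0] true at every index, so no bound is ever checked. *)
Let r_ (i : nat) := nth 0 central_eqs i.
Let r0 i : r_ i = 0.
Proof.
have [lt_i|ge_i] := ltnP i (size central_eqs); last by rewrite /r_ nth_default.
exact/eqP/(all_nthP 0 central).
Qed.

Lemma otrC a b : otr (omul a b) = otr (omul b a).
Proof.
case: a b => [a0 a1 a2 a3 a4 a5 a6 a7] [b0 b1 b2 b3 b4 b5 b6 b7].
(* [k] is the h-coordinate of a 2 x 2 minor of the coordinates of a and b over Q[h]. The form kills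
   [c_i, c_j] identically, and its value on h [c_i, c_j] is, up to sign, relation (2) or (3). *)
pose k s t s' t' p q p' q' := (s * q' + s' * q + u * (s' * q')) - (t * p' + t' * p + u * (t' * p')).
apply/eqP; rewrite -subr_eq0; apply/eqP; transitivity
  (k a1 a2 a5 a6 b1 b2 b5 b6 * r_ 5 - k a1 a3 a5 a7 b1 b3 b5 b7 * r_ 4
   + k a2 a3 a6 a7 b2 b3 b6 b7 * r_ 3).
  by rewrite /k /r_ /otr /dot /omul /=; ring.
by rewrite !r0 !mulr0 subr0 addr0.
Qed.

(* Relation (4) transported to the products c1^-1 c3 = c2 and c3 c2^-1 = c1. *)
Let f1 : u * (x1 * y3 - y2) - x1 * x3 + 2 * x2 - y1 * y3 = 0.
Proof.
apply: two_inj; transitivity (- (u * r_ 4) - x1 * r_ 6 - x2 * r_ 0 - y1 * r_ 5).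
  by rewrite /r_ /=; ring.
by rewrite !r0 !mulr0 !subr0 oppr0.
Qed.

Let f2 : u * (x2 * y3 - y1) - x2 * x3 + 2 * x1 - y2 * y3 = 0.
Proof.
apply: two_inj; transitivity (- (u * r_ 3) - x2 * r_ 6 - x1 * r_ 1 - y2 * r_ 5).
  by rewrite /r_ /=; ring.
by rewrite !r0 !mulr0 !subr0 oppr0.
Qed.

Lemma otr_star a b : otr (omul a b) + otr (omul a (ostar b)) = otr a * otr b.
Proof.
case: a b => [a0 a1 a2 a3 a4 a5 a6 a7] [b0 b1 b2 b3 b4 b5 b6 b7].
(* On basis pairs the defect is (2) or (3) at (c_i, h c_j) with i <> j, (1) at (h c_i, h c_i), (4)
   at (h c1, h c2), and [f1], [f2] at (h c1, h c3), (h c2, h c3). Exchanging the two factors costs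
   multiples of u times (2) or (3). *)
apply/eqP; rewrite -subr_eq0; apply/eqP; transitivity
  ((a1 * b6 - a2 * b5) * r_ 5 + (a3 * b5 - a1 * b7) * r_ 4 + (a2 * b7 - a3 * b6) * r_ 3
   - a5 * b5 * r_ 0 - a6 * b6 * r_ 1 - a7 * b7 * r_ 2
   - (a5 * b6 + a6 * b5) * r_ 6 - u * (a6 * b5) * r_ 5
   + u * (a7 * b5) * r_ 4 + u * (a6 * b7) * r_ 3
   + (a5 * b7 + a7 * b5) * (u * (x1 * y3 - y2) - x1 * x3 + 2 * x2 - y1 * y3)
   + (a6 * b7 + a7 * b6) * (u * (x2 * y3 - y1) - x2 * x3 + 2 * x1 - y2 * y3)).
  by rewrite /r_ /otr /dot /omul /=; ring.
by rewrite f1 f2 !r0 !mulr0 !subr0 !addr0.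
Qed.

(** Relations (5)-(12) with s = S_p(x), r = S_(p-1)(x), s' = S_q(u), r' = S_(q-1)(u), the
    shifted polynomials and the T's being eliminated by the recurrence. *)
Section Power.
Variables (s r s' r' : Q).

Definition pow_eqs1 : seq Q :=
  [:: (u * s' - 2 * r') - (x1 * s - 2 * r);
      u * (u * s' - r') - 2 * s' - s * y1 + r * u;
      s' * y1 - r' * x1 - (x1 * (x1 * s - r) - 2 * s);
      s' * y2 - r' * x2 - s * x3 + r * x2;
      (u * s' - r') * y1 - s' * x1 - (x1 * s - r) * y1 + s * u;
      s' * y3 - r' * x3 - (x1 * s - r) * x3 + s * x2;
      (u * s' - r') * y2 - s' * x2 - s * y3 + r * y2].

Definition pow_eqs2 : seq Q :=
  [:: (u * s' - 2 * r') - (x2 * s - 2 * r);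
      u * (u * s' - r') - 2 * s' - s * y2 + r * u;
      s' * y2 - r' * x2 - (x2 * (x2 * s - r) - 2 * s);
      s' * y1 - r' * x1 - s * x3 + r * x1;
      (u * s' - r') * y2 - s' * x2 - (x2 * s - r) * y2 + s * u;
      s' * y3 - r' * x3 - (x2 * s - r) * x3 + s * x1;
      (u * s' - r') * y1 - s' * x1 - s * y3 + r * y1].

Definition pow_eqs3 : seq Q :=
  [:: (u * s' - 2 * r') - (x3 * s - 2 * r);
      u * (u * s' - r') - 2 * s' - s * y3 + r * u;
      s' * y3 - r' * x3 - (x3 * (x3 * s - r) - 2 * s);
      (u * s' - r') * y3 - s' * x3 - (x3 * s - r) * y3 + s * u;
      s' * y2 - r' * x2 - (x3 * s - r) * x2 + s * x1;
      s' * y1 - r' * x1 - (x3 * s - r) * x1 + s * x2;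
      (u * s' - r') * y1 - s' * x1 - s * (x1 * y3 - y2) + r * y1;
      (u * s' - r') * y2 - s' * x2 - s * (x2 * y3 - y1) + r * y2].

Let all0 (e : seq Q) : all (eq_op^~ 0) e -> forall i, e`_i = 0.
Proof.
move=> e0 i; have [lt_i|ge_i] := ltnP i (size e); last by rewrite nth_default.
exact/eqP/(all_nthP 0 e0).
Qed.

(* The value at [h c1 c2] is not among the equations: it comes from the
   four-variable trace identity
   2 t(zabc) = t(z) t(abc) + t(a) t(zbc) + t(b) t(zac) + t(c) t(zab)
     + t(za) t(bc) - t(zb) t(ac) + t(zc) t(ab) - t(a) t(b) t(zc)
     - t(z) t(a) t(bc) - t(z) t(c) t(ab) - t(b) t(c) t(za) + t(z) t(a) t(b) t(c). *)
Lemma otr_pow1 : all (eq_op^~ 0) pow_eqs1 <->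
  forall v, otr (omul (ocomb s oc1 r oone) v)
          = otr (omul (ocomb s' oh r' oone) v).
Proof.
pose d v := otr (omul (ocomb s oc1 r oone) v) - otr (omul (ocomb s' oh r' oone) v).
split=> [/all0 e|e].
  set e' := nth 0 _ in e.
  have e7 : s * (x1 * y3 - y2) - r * y3 - ((u * s' - r') * y3 - s' * x3) = 0.
    (* The four-variable identity is taken at z = (s c1 - r) - (s' h - r'), a = h, b = c1, c = c2,
       where [e'] lists the values of -t(z v). The multiple of [s] accounts for products whose order
       differs. *)
    apply: two_inj; transitivity
     (- y3 * e' 0 - u * e' 5 - x1 * e' 6 - x2 * e' 4 - x3 * e' 1 + y2 * e' 2
      - y1 * e' 3 + u * x1 * e' 3 + u * x3 * e' 0 + x2 * y1 * e' 0
      + x1 * x2 * e' 1 - u * x1 * x2 * e' 0 - s * (2 * r_ 4 + x1 * r_ 5)).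
      by rewrite /e' /r_ /=; ring.
    by rewrite !e !r0 ?mulr0 !(addr0, subr0, mulr0).
  case=> a0 a1 a2 a3 a4 a5 a6 a7; apply/eqP; rewrite -subr_eq0; apply/eqP.
  transitivity (- a0 * e' 0 - a4 * e' 1 - a1 * e' 2 - a2 * e' 3 - a5 * e' 4
    - a3 * e' 5 - a6 * e' 6
    + a7 * (s * (x1 * y3 - y2) - r * y3 - ((u * s' - r') * y3 - s' * x3))).
    by rewrite /e' /r_ /otr /dot /omul /=; ring.
  by rewrite e7 !e ?r0 !mulr0 !(addr0, subr0).
have d0 w v : w = - d v -> w == 0 by move=> ->; rewrite /d e subrr oppr0.
rewrite /pow_eqs1 /=; do ![apply/andP; split] => //.
- by apply: (d0 _ oone); rewrite /d /otr /dot /omul /=; ring.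
- by apply: (d0 _ oh); rewrite /d /otr /dot /omul /=; ring.
- by apply: (d0 _ oc1); rewrite /d /otr /dot /omul /=; ring.
- by apply: (d0 _ oc2); rewrite /d /otr /dot /omul /=; ring.
- by apply: (d0 _ ohc1); rewrite /d /otr /dot /omul /=; ring.
- by apply: (d0 _ oc3); rewrite /d /otr /dot /omul /=; ring.
- by apply: (d0 _ ohc2); rewrite /d /otr /dot /omul /=; ring.
Qed.

(** The power of c2 stands on the right because c1 c2 = c3 and c3 c2 = x2 c3 - c1 are short, whereas
    c2 c1 has four terms. The value at h c3 again comes from the halved four-variable identity. *)
Lemma otr_pow2 : all (eq_op^~ 0) pow_eqs2 <->
  forall v, otr (omul v (ocomb s oc2 r oone))
          = otr (omul v (ocomb s' oh r' oone)).
Proof.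
pose d v := otr (omul v (ocomb s oc2 r oone)) - otr (omul v (ocomb s' oh r' oone)).
split=> [/all0 e|e].
  set e' := nth 0 _ in e.
  have e7 : s * (x2 * y3 - y1) - r * y3 - ((u * s' - r') * y3 - s' * x3) = 0.
    apply: two_inj; transitivity
     (- y3 * e' 0 - u * e' 5 - x1 * e' 4 - x2 * e' 6 - x3 * e' 1 + y2 * e' 3
      - y1 * e' 2 + u * x1 * e' 2 + u * x3 * e' 0 + x2 * y1 * e' 0
      + x1 * x2 * e' 1 - u * x1 * x2 * e' 0).
      by rewrite /e' /r_ /=; ring.
    by rewrite !e ?r0 ?mulr0 !(addr0, subr0, mulr0).
  case=> a0 a1 a2 a3 a4 a5 a6 a7; apply/eqP; rewrite -subr_eq0; apply/eqP.
  transitivity (- a0 * e' 0 - a4 * e' 1 - a2 * e' 2 - a1 * e' 3 - a6 * e' 4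
    - a3 * e' 5 - a5 * e' 6
    + a7 * (s * (x2 * y3 - y1) - r * y3 - ((u * s' - r') * y3 - s' * x3))).
    by rewrite /e' /r_ /otr /dot /omul /=; ring.
  by rewrite e7 !e ?r0 !mulr0 !(addr0, subr0).
have d0 w v : w = - d v -> w == 0 by move=> ->; rewrite /d e subrr oppr0.
rewrite /pow_eqs2 /=; do ![apply/andP; split] => //.
- by apply: (d0 _ oone); rewrite /d /otr /dot /omul /=; ring.
- by apply: (d0 _ oh); rewrite /d /otr /dot /omul /=; ring.
- by apply: (d0 _ oc2); rewrite /d /otr /dot /omul /=; ring.
- by apply: (d0 _ oc1); rewrite /d /otr /dot /omul /=; ring.
- by apply: (d0 _ ohc2); rewrite /d /otr /dot /omul /=; ring.
- by apply: (d0 _ oc3); rewrite /d /otr /dot /omul /=; ring.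
- by apply: (d0 _ ohc1); rewrite /d /otr /dot /omul /=; ring.
Qed.

(** All eight basis values are among the equations, so nothing is halved. Only at h c1 does the form
    differ: c3 c1 = x3 c1 + c2 - x2 yields x3 y1 + y2 - u x2, which equals the x1 y3 - y2 of (12)
    modulo (2). *)
Lemma otr_pow3 : all (eq_op^~ 0) pow_eqs3 <->
  forall v, otr (omul (ocomb s oc3 r oone) v)
          = otr (omul (ocomb s' oh r' oone) v).
Proof.
pose d v := otr (omul (ocomb s oc3 r oone) v) - otr (omul (ocomb s' oh r' oone) v).
split=> [/all0 e|e].
  set e' := nth 0 _ in e.
  case=> a0 a1 a2 a3 a4 a5 a6 a7; apply/eqP; rewrite -subr_eq0; apply/eqP.
  transitivity (- a0 * e' 0 - a4 * e' 1 - a3 * e' 2 - a7 * e' 3 - a2 * e' 4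
    - a1 * e' 5 - a5 * e' 6 - a6 * e' 7 + s * a5 * r_ 4).
    by rewrite /e' /r_ /otr /dot /omul /=; ring.
  by rewrite !e ?r0 !mulr0 !(addr0, subr0).
have d0 w v : w = - d v -> w == 0 by move=> ->; rewrite /d e subrr oppr0.
rewrite /pow_eqs3 /=; do ![apply/andP; split] => //.
- by apply: (d0 _ oone); rewrite /d /otr /dot /omul /=; ring.
- by apply: (d0 _ oh); rewrite /d /otr /dot /omul /=; ring.
- by apply: (d0 _ oc3); rewrite /d /otr /dot /omul /=; ring.
- by apply: (d0 _ ohc3); rewrite /d /otr /dot /omul /=; ring.
- by apply: (d0 _ oc2); rewrite /d /otr /dot /omul /=; ring.
- by apply: (d0 _ oc1); rewrite /d /otr /dot /omul /=; ring.
- apply/eqP; transitivity (s * r_ 4 - d ohc1).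
    by rewrite /d /r_ /otr /dot /omul /=; ring.
  by rewrite r0 /d e mulr0 subrr subr0.
- by apply: (d0 _ ohc2); rewrite /d /otr /dot /omul /=; ring.
Qed.

End Power.

End Trace.
End Oct.

(** * From the relations to a trace function on the group *)

Section Character.
Variables (Q : comNzRingType) (p1 p2 p3 : nat) (q1 q2 q3 : int).
Variables (u x1 x2 x3 y1 y2 y3 : Q).

Local Notation omul := (omul u x1 x2 x3).
Local Notation ostar := (ostar u x1 x2 x3).
Local Notation rho := (rho u x1 x2 x3).
Local Notation otr := (otr u x1 x2 x3 y1 y2 y3).
Local Notation S := chebS.

Lemma rho_h : rho w_h = oh Q.
Proof. by rewrite /= /olet /ogen /= inordK // omulo1. Qed.

Lemma rho_c1 : rho w_c1 = oc1 Q.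
Proof. by rewrite /= /olet /ogen /= inordK // omulo1. Qed.

Lemma rho_c2 : rho w_c2 = oc2 Q.
Proof. by rewrite /= /olet /ogen /= inordK // omulo1. Qed.

Lemma rho_c3 : rho w_c3 = oc3 Q.
Proof. by rewrite rho_cat rho_c1 rho_c2 /omul /=; congr Oct; ring. Qed.

Lemma rho_hC w : rho (w_h ++ w) = rho (w ++ w_h).
Proof.
rewrite !rho_cat rho_h; case: (rho w) => * /=.
by rewrite /omul /=; congr Oct; ring.
Qed.

Lemma rho_pow_h z : rho (wpow w_h z) = ocomb (S z u) (oh Q) (S (z - 1) u) (oone Q).
Proof.
by rewrite (@rho_pow _ _ _ _ _ _ u) rho_h //; rewrite /oone /omul /=; congr Oct; ring.
Qed.

Lemma rho_pow_c1 z : rho (wpow w_c1 z) = ocomb (S z x1) (oc1 Q) (S (z - 1) x1) (oone Q).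
Proof.
by rewrite (@rho_pow _ _ _ _ _ _ x1) rho_c1 //; rewrite /oone /omul /=; congr Oct; ring.
Qed.

Lemma rho_pow_c2 z : rho (wpow w_c2 z) = ocomb (S z x2) (oc2 Q) (S (z - 1) x2) (oone Q).
Proof.
by rewrite (@rho_pow _ _ _ _ _ _ x2) rho_c2 //; rewrite /oone /omul /=; congr Oct; ring.
Qed.

Lemma rho_pow_c3 z : rho (wpow w_c3 z) = ocomb (S z x3) (oc3 Q) (S (z - 1) x3) (oone Q).
Proof.
by rewrite (@rho_pow _ _ _ _ _ _ x3) rho_c3 //; rewrite /oone /omul /=; congr Oct; ring.
Qed.

Definition char_eqs : seq Q :=
  central_eqs u x1 x2 x3 y1 y2 y3
  ++ pow_eqs1 u x1 x2 x3 y1 y2 y3 (S p1 x1) (S (p1%:Z - 1) x1) (S q1 u) (S (q1 - 1) u)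
  ++ pow_eqs2 u x1 x2 x3 y1 y2 y3 (S p2 x2) (S (p2%:Z - 1) x2) (S q2 u) (S (q2 - 1) u)
  ++ pow_eqs3 u x1 x2 x3 y1 y2 y3 (S p3 x3) (S (p3%:Z - 1) x3) (S q3 u) (S (q3 - 1) u).

Hypothesis two_inj : forall a : Q, 2 * a = 0 -> a = 0.

(** The commutator relators and the cancelling pairs already map to 1 in the algebra, h being
    central there. A power relator is removed only under the form: cyclicity puts it in front,
    c_i^(p_i) becomes h^(q_i), and this cancels against h^(-q_i). *)
Lemma char_eqs_trace : all (eq_op^~ 0) char_eqs ->
  trace_fun p1 p2 p3 q1 q2 q3 (fun w => otr (rho w)).
Proof.
rewrite !all_cat => /and4P [ctr].
move=> /(otr_pow1 two_inj ctr) e1 /(otr_pow2 _ _ _ _ _ _ _ two_inj) e2 /(otr_pow3 ctr) e3.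
have pow_rel w p q :
    (forall v, otr (omul (rho (wpow w p)) v) = otr (omul (rho (wpow w_h q)) v)) ->
    forall w1 w2, otr (rho (w1 ++ (wpow w p ++ wpow w_h (- q)) ++ w2)) = otr (rho (w1 ++ w2)).
  move=> e w1 w2; rewrite !rho_cat wpowN.
  rewrite (otrC ctr) -!omulA e [in LHS]omulA rho_mulV omul1o.
  by rewrite (otrC ctr).
have one_rel r : rho r = oone Q ->
    forall w1 w2, otr (rho (w1 ++ r ++ w2)) = otr (rho (w1 ++ w2)).
  by move=> e w1 w2; rewrite !rho_cat e omul1o.
split; last split; last split.
- move=> w1 w2; split=> [l|r].
    by apply: one_rel; rewrite /= omulo1 olet_flip.
  rewrite !inE => /or4P [/eqP->|/eqP->|/eqP->|/orP [/eqP->|/eqP->]].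
  + by apply: one_rel; rewrite catA -winv_cat rho_cat rho_hC rho_mulV.
  + by apply: one_rel; rewrite catA -winv_cat rho_cat rho_hC rho_mulV.
  + by apply: pow_rel => v; rewrite rho_pow_c1 rho_pow_h.
  (* The equations for c2 concern multiplication on the right, hence the two uses of cyclicity. *)
  + apply: pow_rel => v; rewrite (otrC ctr) rho_pow_c2 e2 (otrC ctr).
    by rewrite rho_pow_h.
  + by apply: pow_rel => v; rewrite rho_pow_c3 rho_pow_h.
- by move=> x y; rewrite !rho_cat rho_inv (otr_star two_inj ctr).
- by move=> x y; rewrite !rho_cat (otrC ctr).
- by rewrite /otr /dot /=; ring.
Qed.

End Character.

(** * From a trace function on the group to the relations *)

Lemma ord3_inord (g : 'I_3) : [\/ g = inord 0, g = inord 1 | g = inord 2].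
Proof.
by case: g => [[|[|[|k]]] lt_k] //; [constructor 1|constructor 2|constructor 3];
   apply: val_inj; rewrite /= inordK.
Qed.

Section TraceFunction.
Variables (A : comNzRingType) (p1 p2 p3 : nat) (q1 q2 q3 : int).
Variables (t : word -> A) (ht : trace_fun p1 p2 p3 q1 q2 q3 t).

Local Notation lh := ((false, inord 0) : letter).
Local Notation lc1 := ((false, inord 1) : letter).
Local Notation lc2 := ((false, inord 2) : letter).

Let tC x y : t (x ++ y) = t (y ++ x).
Proof. by case: ht => _ [_ [->]]. Qed.

Let t_cancel z l v : t (z ++ l :: flip l :: v) = t (z ++ v).
Proof. by case: ht => d _; case: (d z v) => /(_ l). Qed.

Let t_relator z r v : r \in relators p1 p2 p3 q1 q2 q3 -> t (z ++ r ++ v) = t (z ++ v).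
Proof. by case: ht => d _; case: (d z v) => _ /(_ r). Qed.

(** Cyclicity carries the middle factor to the end of the word, where the trace identity applies. *)
Lemma trace_inv z w v : t (z ++ winv w ++ v) = t w * t (z ++ v) - t (z ++ w ++ v).
Proof.
have [_ [tM _]] := ht.
have := tM (v ++ z) w; rewrite -!catA !(tC v) -!catA => e.
by rewrite [t w * _]mulrC -e addrC addKr.
Qed.

Lemma trace_letter_inv z l v :
  t (z ++ flip l :: v) = t [:: l] * t (z ++ v) - t (z ++ l :: v).
Proof. exact: (trace_inv z [:: l] v). Qed.

Lemma trace_sq z l v : t (z ++ l :: l :: v) = t [:: l] * t (z ++ l :: v) - t (z ++ v).
Proof.
have := trace_letter_inv z l (l :: v).
by rewrite -{2}[l]flipK t_cancel => ->; ring.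
Qed.

(** Two expansions of t(z b^-1 a^-1 v) are compared: as the inverse of the block ab, and letter by
    letter. *)
Lemma trace_swap z a b v : t (z ++ b :: a :: v) =
  - t (z ++ a :: b :: v) + t [:: b] * t (z ++ a :: v) + t [:: a] * t (z ++ b :: v)
  + (t [:: a; b] - t [:: a] * t [:: b]) * t (z ++ v).
Proof.
have e : t (z ++ flip b :: flip a :: v)
    = t [:: a; b] * t (z ++ v) - t (z ++ a :: b :: v) := trace_inv z [:: a; b] v.
have := trace_letter_inv (rcons z b) a v; rewrite !cat_rcons => e'.
move: e; rewrite !trace_letter_inv e' => /eqP; rewrite -subr_eq0 => /eqP e.
by apply/eqP; rewrite -subr_eq0 -e; apply/eqP; ring.
Qed.

Let trace_central z c v :
    w_h ++ [:: c] ++ winv w_h ++ winv [:: c] \in relators p1 p2 p3 q1 q2 q3 ->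
  t (z ++ c :: lh :: v) = t (z ++ lh :: c :: v).
Proof.
(* Inserting the relator before c h gives h c h^-1 c^-1 c h, and two cancellations leave h c. *)
move=> rel; rewrite -(t_relator z (c :: lh :: v) rel) /=.
transitivity (t ((z ++ [:: lh; c; flip lh]) ++ flip c :: flip (flip c) :: lh :: v)).
  by rewrite flipK -catA.
rewrite t_cancel -catA.
transitivity (t ((z ++ [:: lh; c]) ++ flip lh :: flip (flip lh) :: v)).
  by rewrite flipK -catA.
by rewrite t_cancel -catA.
Qed.

Let trace_c1h z v : t (z ++ lc1 :: lh :: v) = t (z ++ lh :: lc1 :: v).
Proof. by apply: trace_central; rewrite mem_head. Qed.

Let trace_c2h z v : t (z ++ lc2 :: lh :: v) = t (z ++ lh :: lc2 :: v).
Proof. by apply: trace_central; rewrite !inE eqxx orbT. Qed.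

Local Notation u := (t w_h).
Local Notation x1 := (t w_c1).
Local Notation x2 := (t w_c2).
Local Notation x3 := (t w_c3).
Local Notation y1 := (t (w_h ++ w_c1)).
Local Notation y2 := (t (w_h ++ w_c2)).
Local Notation y3 := (t (w_h ++ w_c3)).
Local Notation omul := (omul u x1 x2 x3).
Local Notation ostar := (ostar u x1 x2 x3).
Local Notation rho := (rho u x1 x2 x3).
Local Notation otr := (otr u x1 x2 x3 y1 y2 y3).

(** The linear form v -> t(z v) as the row of its values on the basis, to be paired with coordinates
    by [dot]. *)
Definition probe z : oct A :=
  Oct (t z) (t (z ++ w_c1)) (t (z ++ w_c2)) (t (z ++ w_c3)) (t (z ++ w_h))
    (t (z ++ w_h ++ w_c1)) (t (z ++ w_h ++ w_c2)) (t (z ++ w_h ++ w_c3)).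

Let sq1 z a l v : t (z ++ a :: l :: l :: v) = t [:: l] * t (z ++ a :: l :: v) - t (z ++ a :: v).
Proof. by rewrite -!cat_rcons !cat_rcons -cat_rcons trace_sq !cat_rcons. Qed.

Let sq2 z a b l v : t (z ++ a :: b :: l :: l :: v) =
  t [:: l] * t (z ++ a :: b :: l :: v) - t (z ++ a :: b :: v).
Proof. by rewrite -cat_rcons sq1 !cat_rcons. Qed.

Let swap1 z c a b v : t (z ++ c :: b :: a :: v) =
  - t (z ++ c :: a :: b :: v) + t [:: b] * t (z ++ c :: a :: v) + t [:: a] * t (z ++ c :: b :: v)
  + (t [:: a; b] - t [:: a] * t [:: b]) * t (z ++ c :: v).
Proof. by rewrite -cat_rcons trace_swap !cat_rcons. Qed.

(** The values of t obey the multiplication table of the algebra: squares, the swap c2 c1 and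
    centrality of h reduce each letter followed by a basis word to basis words. *)
Lemma dot_probe_letter z l v :
  dot (probe (z ++ [:: l])) v = dot (probe z) (omul (olet u x1 x2 x3 l) v).
Proof.
have gen_step g : dot (probe (z ++ [:: (false, g)])) v
    = dot (probe z) (omul (ogen A g) v).
  case: v => v0 v1 v2 v3 v4 v5 v6 v7.
  have [->|->|->] : [\/ g = inord 0, g = inord 1 | g = inord 2].
    exact: ord3_inord.
  - rewrite {1}/ogen [val _]/= inordK // /probe -!catA /dot /omul /=.
    rewrite !trace_sq -![[:: lh]]/w_h cats0.
    by ring.
  - rewrite {1}/ogen [val _]/= inordK // /probe -!catA /dot /omul /=.
    rewrite !trace_c1h ?trace_sq ?sq1 -![[:: lc1]]/w_c1 ?cats0.
    by ring.
  - rewrite {1}/ogen [val _]/= inordK // /probe -!catA /dot /omul /=.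
    rewrite !trace_c2h ?trace_sq ?sq1 ?(trace_swap _ lc1 lc2) ?(swap1 _ _ lc1 lc2).
    rewrite ?trace_sq ?sq1 ?sq2 ?cats0.
    rewrite -![[:: lc1]]/w_c1 -![[:: lc2]]/w_c2.
    by ring.
(* An inverse letter is reduced to a positive one by g^-1 = t_g - g. *)
case: l => [[] g]; last exact: gen_step.
have inv := trace_letter_inv z (false, g); rewrite [flip _]/= in inv.
rewrite (_ : dot (probe (z ++ [:: (true, g)])) v
    = t [:: (false, g)] * dot (probe z) v - dot (probe (z ++ [:: (false, g)])) v); last first.
  case: v {gen_step} => v0 v1 v2 v3 v4 v5 v6 v7.
  by rewrite /probe -!catA /dot /= !inv cats0; ring.
rewrite gen_step {gen_step}.
have [->|->|->] : [\/ g = inord 0, g = inord 1 | g = inord 2] by exact: ord3_inord.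
all: rewrite /olet /ogen [val _]/= inordK //; case: v => v0 v1 v2 v3 v4 v5 v6 v7.
all: by rewrite /omul /dot /probe /=; ring.
Qed.

(** Induction with arbitrary prefix, letters passing one by one from w to z. At the empty prefix the
    probe is the row 2, x_i, u, y_i of the trace form. *)
Lemma trace_expand w z : t (z ++ w) = dot (probe z) (rho w).
Proof.
elim: w z => [|l w IH] z; first by rewrite cats0 /dot /=; ring.
by rewrite -cat_rcons -cats1 IH dot_probe_letter.
Qed.

Lemma traceE w : t w = otr (rho w).
Proof.
rewrite -[t w]/(t ([::] ++ w)) trace_expand /otr /probe /=.
by have [_ [_ [_ ->]]] := ht.
Qed.

Lemma omul_oh_oc1 : omul (oh A) (oc1 A) = ohc1 A.
Proof. by rewrite /omul /=; congr Oct; ring. Qed.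
Lemma omul_oh_oc2 : omul (oh A) (oc2 A) = ohc2 A.
Proof. by rewrite /omul /=; congr Oct; ring. Qed.
Lemma omul_oh_oc3 : omul (oh A) (oc3 A) = ohc3 A.
Proof. by rewrite /omul /=; congr Oct; ring. Qed.

Let rho_hc1 : rho (w_h ++ w_c1) = ohc1 A.
Proof. by rewrite rho_cat rho_h rho_c1 omul_oh_oc1. Qed.
Let rho_hc2 : rho (w_h ++ w_c2) = ohc2 A.
Proof. by rewrite rho_cat rho_h rho_c2 omul_oh_oc2. Qed.
Let rho_hc3 : rho (w_h ++ w_c3) = ohc3 A.
Proof. by rewrite rho_cat rho_h rho_c3 omul_oh_oc3. Qed.

Let otr_comm x y : otr (omul (rho x) (rho y)) = otr (omul (rho y) (rho x)).
Proof. by rewrite -!rho_cat -!traceE tC. Qed.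

Let otr_starM x y : otr (omul (rho x) (rho y)) + otr (omul (rho x) (ostar (rho y)))
  = otr (rho x) * otr (rho y).
Proof. by rewrite -rho_inv -!rho_cat -!traceE; have [_ [-> _]] := ht. Qed.

Lemma trace_central_eqs : all (eq_op^~ 0) (central_eqs u x1 x2 x3 y1 y2 y3).
Proof.
have comm0 x y : otr (omul (rho x) (rho y)) - otr (omul (rho y) (rho x)) = 0.
  by rewrite otr_comm subrr.
have star0 x y : otr (rho x) * otr (rho y)
   - (otr (omul (rho x) (rho y)) + otr (omul (rho x) (ostar (rho y)))) = 0.
  by rewrite otr_starM subrr.
rewrite /central_eqs /=; do ![apply/andP; split] => //; apply/eqP.
- have <- := star0 (w_h ++ w_c1) (w_h ++ w_c1); rewrite !rho_hc1.
  by rewrite /otr /dot /omul /=; ring.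
- have <- := star0 (w_h ++ w_c2) (w_h ++ w_c2); rewrite !rho_hc2.
  by rewrite /otr /dot /omul /=; ring.
- have <- := star0 (w_h ++ w_c3) (w_h ++ w_c3); rewrite !rho_hc3.
  by rewrite /otr /dot /omul /=; ring.
- have <- := comm0 w_c2 (w_h ++ w_c3); rewrite rho_c2 rho_hc3.
  by rewrite /otr /dot /omul /=; ring.
- have <- := comm0 (w_h ++ w_c3) w_c1; rewrite rho_c1 rho_hc3.
  by rewrite /otr /dot /omul /=; ring.
- have <- := comm0 w_c1 (w_h ++ w_c2); rewrite rho_c1 rho_hc2.
  by rewrite /otr /dot /omul /=; ring.
- have <- := star0 (w_h ++ w_c1) (w_h ++ w_c2); rewrite rho_hc1 rho_hc2.
  by rewrite /otr /dot /omul /=; ring.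
Qed.

Let otr_basis a v : otr (omul a v) =
  let: Oct v0 v1 v2 v3 v4 v5 v6 v7 := v in
  v0 * otr (omul a (oone A)) + v1 * otr (omul a (oc1 A))
  + v2 * otr (omul a (oc2 A)) + v3 * otr (omul a (oc3 A))
  + v4 * otr (omul a (oh A)) + v5 * otr (omul a (ohc1 A))
  + v6 * otr (omul a (ohc2 A)) + v7 * otr (omul a (ohc3 A)).
Proof.
case: a v => [a0 a1 a2 a3 a4 a5 a6 a7] [v0 v1 v2 v3 v4 v5 v6 v7].
by rewrite /otr /dot /omul /=; ring.
Qed.

(** Every basis element is the image of a word, so invariance under the relator, known on words,
    extends linearly to the whole algebra. *)
Let trace_pow w p q :
    wpow w p ++ wpow w_h (- q) \in relators p1 p2 p3 q1 q2 q3 ->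
  forall v, otr (omul (rho (wpow w p)) v) = otr (omul (rho (wpow w_h q)) v).
Proof.
move=> rel.
have e w' : otr (omul (rho (wpow w p)) (rho w')) = otr (omul (rho (wpow w_h q)) (rho w')).
  transitivity (t (wpow w p ++ w')); first by rewrite -rho_cat -traceE.
  transitivity (t (wpow w_h q ++ w')); last by rewrite -rho_cat -traceE.
  (* Inserted before h^q w', the relator yields w^p h^(-q) h^q w'. *)
  rewrite -(t_relator [::] (wpow w_h q ++ w') rel) /=.
  rewrite [LHS]traceE [RHS]traceE !rho_cat wpowN -!omulA [omul (rho (winv _)) _]omulA.
  have -> : omul (rho (winv (wpow w_h q))) (rho (wpow w_h q)) = oone A.
    by rewrite -[X in omul _ (rho X)]winvK rho_mulV.
  by rewrite omul1o.
case=> v0 v1 v2 v3 v4 v5 v6 v7; rewrite [LHS]otr_basis [RHS]otr_basis.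
have e1 : otr (omul _ (oone A)) = otr (omul _ (oone A)) := e [::].
have e2 := e w_c1; rewrite rho_c1 in e2.
have e3 := e w_c2; rewrite rho_c2 in e3.
have e4 := e w_c3; rewrite rho_c3 in e4.
have e5 := e w_h; rewrite rho_h in e5.
have e6 := e (w_h ++ w_c1); rewrite rho_hc1 in e6.
have e7 := e (w_h ++ w_c2); rewrite rho_hc2 in e7.
have e8 := e (w_h ++ w_c3); rewrite rho_hc3 in e8.
by rewrite e1 e2 e3 e4 e5 e6 e7 e8.
Qed.

Hypothesis two_inj : forall a : A, 2 * a = 0 -> a = 0.

Lemma trace_char_eqs :
  all (eq_op^~ 0) (char_eqs p1 p2 p3 q1 q2 q3 u x1 x2 x3 y1 y2 y3).
Proof.
have ctr := trace_central_eqs.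
rewrite !all_cat; apply/and4P; split=> //.
- apply/(otr_pow1 two_inj ctr) => v; rewrite -(rho_pow_c1 u x1 x2 x3) -(rho_pow_h u x1 x2 x3).
  by apply: trace_pow; rewrite !inE eqxx !orbT.
- apply/(otr_pow2 _ _ _ _ _ _ _ two_inj) => v.
  rewrite -(rho_pow_c2 u x1 x2 x3) -(rho_pow_h u x1 x2 x3).
  rewrite !(otrC ctr v).
  by apply: trace_pow; rewrite !inE eqxx !orbT.
- apply/(otr_pow3 ctr) => v; rewrite -(rho_pow_c3 u x1 x2 x3) -(rho_pow_h u x1 x2 x3).
  by apply: trace_pow; rewrite !inE eqxx !orbT.
Qed.

End TraceFunction.

(** * Quotients of commutative algebras *)

Section QuotientAlgebra.
Local Open Scope quotient_scope.
Variables (C : fieldType) (P : comAlgType C) (I : idealr P).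
Local Notation Q := {ideal_quot I}.

Definition quot_scale (c : C) (b : Q) : Q := \pi_Q (c *: repr b).

(** A scalar acts as multiplication by an element of the algebra, which preserves the ideal; the
    chosen representative is thus irrelevant. *)
Lemma pi_scale c x : quot_scale c (\pi_Q x) = \pi_Q (c *: x).
Proof.
apply/eqP; rewrite -Quotient.idealrBE -scalerBr -mulr_algl.
apply: idealMr.
rewrite Quotient.idealrBE.
by rewrite reprK.
Qed.

Let pi_add (x y : P) : \pi_Q x + \pi_Q y = \pi_Q (x + y).
Proof. by rewrite rmorphD. Qed.
Let pi_mul (x y : P) : \pi_Q x * \pi_Q y = \pi_Q (x * y).
Proof. by rewrite rmorphM. Qed.

Fact quot_scalerA a b q : quot_scale a (quot_scale b q) = quot_scale (a * b) q.
Proof. by rewrite -[q]reprK (pi_scale b) !(pi_scale, scalerA). Qed.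
Fact quot_scale1r : left_id 1 quot_scale.
Proof. by move=> q; rewrite -[q]reprK pi_scale scale1r. Qed.
Fact quot_scalerDr : right_distributive quot_scale +%R.
Proof.
by move=> c x y; rewrite -[x]reprK -[y]reprK pi_add !pi_scale pi_add scalerDr.
Qed.
Fact quot_scalerDl q : {morph quot_scale^~ q : a b / a + b}.
Proof. by move=> a b; rewrite -[q]reprK !pi_scale pi_add scalerDl. Qed.

HB.instance Definition _ := GRing.Zmodule_isLmodule.Build C Q
  quot_scalerA quot_scale1r quot_scalerDr quot_scalerDl.

Fact quot_scalerAl (c : C) (p q : Q) : c *: (p * q) = (c *: p) * q.
Proof.
rewrite -[p]reprK -[q]reprK.
by rewrite /GRing.scale /= pi_mul !pi_scale pi_mul scalerAl.
Qed.

HB.instance Definition _ := GRing.Lmodule_isLalgebra.Build C Q quot_scalerAl.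

Fact quot_scalerAr (c : C) (p q : Q) : c *: (p * q) = p * (c *: q).
Proof. by rewrite mulrC quot_scalerAl mulrC. Qed.

HB.instance Definition _ := GRing.Lalgebra_isAlgebra.Build C Q quot_scalerAr.

Lemma quotient_algebra_of_idealr :
  exists (B : comAlgType C) (f : {lrmorphism P -> B}),
    (forall b, exists x, f x = b) /\ (forall x, f x = 0 <-> x \in I).
Proof.
pose p (x : P) : Q := \pi_Q x.
have pl : linear p by move=> c x y; rewrite /p -pi_add -pi_scale.
have pm : monoid_morphism p.
  by split=> [|x y]; rewrite /p ?rmorph1 -?pi_mul.
pose pL := GRing.isLinear.Build C P Q *:%R p pl.
pose pM := GRing.isMonoidMorphism.Build P Q p pm.
pose pLM : {lrmorphism P -> Q} := HB.pack p pL pM.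
exists Q, pLM; split=> [b|x]; first by exists (repr b); exact: reprK.
have p0 : p 0 = 0 by exact: (rmorph0 pLM).
rewrite -[x in x \in I]subr0 Quotient.idealrBE -/(p x) -/(p 0) p0 [pLM x]/(p x).
by split=> [e|/eqP e]; [apply/eqP|]; exact: e.
Qed.

End QuotientAlgebra.

(** Properness of J ensures 1 <> 0 in the quotient, as the algebra structure demands. Classical
    logic makes J a Boolean predicate. *)
Lemma quotient_algebra (C : fieldType) (P : comAlgType C) (J : P -> Prop) :
    J 0 -> (forall x y, J x -> J y -> J (x + y)) ->
    (forall a x, J x -> J (a * x)) -> ~ J 1 ->
  exists (B : comAlgType C) (f : {lrmorphism P -> B}),
    (forall b, exists x, f x = b) /\ (forall x, f x = 0 <-> J x).
Proof.
move=> J0 JD JM J1.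
pose K : {pred P} := fun x => `[< J x >].
have JN x : J x -> J (- x) by rewrite -mulN1r; apply: JM.
have Kz : zmod_closed K.
  split; first exact/asboolP.
  by move=> x y /asboolP Jx /asboolP Jy; apply/asboolP/JD/JN.
have Ki : 1 \notin K /\ forall a, {in K, forall x, a * x \in K}.
  split; first by apply/asboolP.
  by move=> a x /asboolP Jx; apply/asboolP/JM.
pose Kzm := GRing.isZmodClosed.Build P K Kz.
pose Kim := isProperIdeal.Build P K Ki.
pose I : idealr P := HB.pack K Kzm Kim.
have [B [f [fs fk]]] := quotient_algebra_of_idealr I.
by exists B, f; split=> // x; rewrite fk; split=> [/asboolP|Jx] //; apply/asboolP.
Qed.

Lemma lrmorphism_factor (C : fieldType) (P B A : comAlgType C)
    (f : {lrmorphism P -> B}) (g : {lrmorphism P -> A}) :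
    (forall b, exists x, f x = b) -> (forall x, f x = 0 -> g x = 0) ->
  exists h : {lrmorphism B -> A}, forall x, h (f x) = g x.
Proof.
(* [s] is a set-theoretic section of f; h = g o s satisfies h o f = g, from which linearity and
   multiplicativity follow. *)
move=> fs fk; pose s b := sval (cid (fs b)).
have fs_ b : f (s b) = b by rewrite /s; case: cid.
pose h b := g (s b).
have hf x : h (f x) = g x.
  have : f (s (f x) - x) = 0 by rewrite rmorphB /= fs_ subrr.
  by move/fk; rewrite rmorphB => /subr0_eq.
have hl : linear h.
  by move=> c a b; rewrite -{1}[a]fs_ -{1}[b]fs_ -linearP hf linearP.
have hm : monoid_morphism h.
  split=> [|a b]; first by rewrite -(rmorph1 f) hf rmorph1.
  by rewrite -{1}[a]fs_ -{1}[b]fs_ -rmorphM hf rmorphM.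
pose hL := GRing.isLinear.Build C B A *:%R h hl.
pose hM := GRing.isMonoidMorphism.Build B A h hm.
pose H : {lrmorphism B -> A} := HB.pack h hL hM.
by exists H.
Qed.

(** * The presentation *)

Lemma chebS_succ (Q : comNzRingType) (n : int) (x : Q) :
  chebS (n + 1) x = x * chebS n x - chebS (n - 1) x.
Proof.
case: n => [[|n]|[|n]].
- by rewrite /=; ring.
- have -> : (n.+1%:Z + 1)%R = n.+2 by lia.
  have -> : (n.+1%:Z - 1)%R = n by lia.
  by [].
- by rewrite /=; ring.
- rewrite (_ : Negz n.+1 + 1 = Negz n); last by lia.
  rewrite (_ : Negz n.+1 - 1 = Negz n.+2 :> int); last by lia.
  rewrite /chebS (_ : chebS_nat x n.+3 = x * chebS_nat x n.+2 - chebS_nat x n.+1) //.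
  by ring.
Qed.

(** Removes T from relations (5)-(7), leaving only S_n and S_(n-1). *)
Lemma chebTE (Q : comNzRingType) (n : int) (x : Q) :
  chebT n x = x * chebS n x - 2 * chebS (n - 1) x.
Proof.
have natE k : chebT_nat x k.+1 = x * chebS_nat x k.+1 - 2 * chebS_nat x k.
  elim/ltn_ind: k => -[|[|k]] IH; [by rewrite /=; ring | by rewrite /=; ring |].
  rewrite (_ : chebT_nat x k.+3 = x * chebT_nat x k.+2 - chebT_nat x k.+1) //.
  rewrite !IH //.
  rewrite (_ : chebS_nat x k.+3 = x * chebS_nat x k.+2 - chebS_nat x k.+1) //.
  rewrite (_ : chebS_nat x k.+2 = x * chebS_nat x k.+1 - chebS_nat x k) //.
  by ring.
case: n => [[|n]|n]; first by rewrite /=; ring.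
- have -> : (n.+1%:Z - 1)%R = n by lia.
  exact: natE.
- rewrite (_ : Negz n - 1 = Negz n.+1 :> int); last by lia.
  rewrite [LHS]natE /chebS.
  rewrite (_ : chebS_nat x n.+2 = x * chebS_nat x n.+1 - chebS_nat x n) //.
  by ring.
Qed.

Lemma rmorph_chebS (P Q : comNzRingType) (f : {rmorphism P -> Q}) (n : int) x :
  f (chebS n x) = chebS n (f x).
Proof.
have natE k : f (chebS_nat x k) = chebS_nat (f x) k.
  elim/ltn_ind: k => -[|[|k]] IH; [by rewrite /= rmorph0 | by rewrite /= rmorph1 |].
  rewrite (_ : chebS_nat x k.+2 = x * chebS_nat x k.+1 - chebS_nat x k) //.
  by rewrite rmorphB rmorphM !IH.
by case: n => n; [exact: natE | rewrite [LHS]rmorphN natE].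
Qed.

(** The trace of a word is an integer polynomial in the seven parameters, hence natural in the
    ring. *)
Lemma rmorph_otr (P Q : comNzRingType) (f : {rmorphism P -> Q}) u x1 x2 x3 y1 y2 y3 w :
  f (otr u x1 x2 x3 y1 y2 y3 (rho u x1 x2 x3 w))
  = otr (f u) (f x1) (f x2) (f x3) (f y1) (f y2) (f y3) (rho (f u) (f x1) (f x2) (f x3) w).
Proof.
pose fo (a : oct P) := let: Oct a0 a1 a2 a3 a4 a5 a6 a7 := a in
  Oct (f a0) (f a1) (f a2) (f a3) (f a4) (f a5) (f a6) (f a7).
have -> : rho (f u) (f x1) (f x2) (f x3) w = fo (rho u x1 x2 x3 w).
  elim: w => [|l w IH] /=; first by rewrite /oone rmorph0 rmorph1.
  rewrite IH.
  have -> : olet (f u) (f x1) (f x2) (f x3) l = fo (olet u x1 x2 x3 l).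
    case: l => b g; rewrite /olet /ogen.
    by case: b; case: (val _) => [|[|k]] /=; congr Oct; ring.
  case: (olet _ _ _ _ _) (rho _ _ _ _ _) => a0 a1 a2 a3 a4 a5 a6 a7 [b0 b1 b2 b3 b4 b5 b6 b7].
  by rewrite /omul /=; congr Oct; ring.
case: (rho _ _ _ _ _) => *; rewrite /otr /dot /=; ring.
Qed.

Lemma gens_char_eqs (C : fieldType) (Q : comNzRingType) p1 p2 p3 q1 q2 q3
    (f : {rmorphism {mpoly C[7]} -> Q}) :
  (forall g, g \in gens C p1 p2 p3 q1 q2 q3 -> f g = 0) <->
  all (eq_op^~ 0) (char_eqs p1 p2 p3 q1 q2 q3 (f (vU C))
    (f (vX C 1)) (f (vX C 2)) (f (vX C 3)) (f (vY C 1)) (f (vY C 2)) (f (vY C 3))).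
Proof.
set e := char_eqs _ _ _ _ _ _ _ _ _ _ _ _ _.
(* [J] gives the place of each generator in [char_eqs], where the power relations are grouped by i
   instead of by type; it permutes 0, ..., 28. *)
pose J := [:: 0; 1; 2; 3; 4; 5; 6; 7; 14; 21; 8; 15; 22; 9; 16; 23; 10; 17;
  11; 18; 24; 12; 19; 25; 26; 13; 20; 27; 28]%N.
have eJ : [seq f g | g <- gens C p1 p2 p3 q1 q2 q3] = [seq e`_j | j <- J].
  rewrite /e /char_eqs -!rmorph_chebS /=.
  have chebT_succ n (x : {mpoly C[7]}) :
      chebT (n + 1) x = x * (x * chebS n x - chebS (n - 1) x) - 2 * chebS n x.
    by rewrite chebTE chebS_succ addrK.
  by do ![congr cons]; rewrite /rel1 /rel2 /rel3 /rel4 /rel5 /rel6 /rel7 /rel8 /rel9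
    /rel10 /rel11 /rel12 /pp /qq ?chebT_succ ?chebTE ?chebS_succ; ring.
have {eJ}-> : all (eq_op^~ 0) e = all (eq_op^~ 0) [seq f g | g <- gens C p1 p2 p3 q1 q2 q3].
  rewrite eJ -{1}[e](mkseq_nth 0) (perm_all _ (perm_map _ (_ : perm_eq J (iota 0 (size e))))) //.
split=> [f0|/allP f0 g gP]; last by apply/eqP/f0/map_f.
by apply/allP => _ /mapP [g gP ->]; rewrite f0.
Qed.

Lemma mpoly_lrmorphism_ext (C : fieldType) n (B : comAlgType C)
    (f g : {lrmorphism {mpoly C[n]} -> B}) :
  (forall i, f 'X_i = g 'X_i) -> f =1 g.
Proof.
move=> fg p; rewrite (mpolyE p) !linear_sum; apply: eq_bigr => m _.
rewrite !linearZ mpolyXE_id !rmorph_prod; congr (_ *: _).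
by apply: eq_bigr => i _; rewrite !rmorphXn; congr (_ ^+ _); apply: fg.
Qed.

(** The universal trace polynomial of a word, the parameters being the variables themselves. *)
Definition generic_trace (C : fieldType) (w : word) : {mpoly C[7]} :=
  otr (vU C) (vX C 1) (vX C 2) (vX C 3) (vY C 1) (vY C 2) (vY C 3)
    (rho (vU C) (vX C 1) (vX C 2) (vX C 3) w).

Lemma generic_trace_var_word (C : fieldType) (i : 'I_7) :
  generic_trace C (var_word i) = 'X_i.
Proof.
have valK k : (k < 7)%N -> val (inord k : 'I_7) = k by move=> lt_k; rewrite /= inordK.
rewrite -(inord_val i); move: (val i) (ltn_ord i) => k.
case: k => [|[|[|[|[|[|[|k]]]]]]] // lt_k; rewrite /generic_trace /var_word valK //
    ?rho_cat ?rho_h ?rho_c1 ?rho_c2 ?rho_c3 /otr /dot /omul /= /vU /vX /vY; ring.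
Qed.

(** * The ideal generated by a list of polynomials *)

Section InIdealGen.
Variables (C : fieldType) (g : seq {mpoly C[7]}).

Lemma in_ideal_gen0 : in_ideal_gen g 0.
Proof.
exists (nseq (size g) 0); rewrite size_nseq; split=> //.
by rewrite big1 // => k _; rewrite nth_nseq if_same mul0r.
Qed.

Lemma in_ideal_genD x y :
  in_ideal_gen g x -> in_ideal_gen g y -> in_ideal_gen g (x + y).
Proof.
move=> [c [_ ->]] [d [_ ->]]; exists (mkseq (fun k => c`_k + d`_k) (size g)).
rewrite size_mkseq; split=> //; rewrite -big_split; apply: eq_bigr => k _.
by rewrite nth_mkseq // mulrDl.
Qed.

Lemma in_ideal_genM a x : in_ideal_gen g x -> in_ideal_gen g (a * x).
Proof.
move=> [c [_ ->]]; exists (mkseq (fun k => a * c`_k) (size g)).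
rewrite size_mkseq; split=> //; rewrite mulr_sumr; apply: eq_bigr => k _.
by rewrite nth_mkseq // mulrA.
Qed.

Lemma in_ideal_gen_mem x : x \in g -> in_ideal_gen g x.
Proof.
move=> gx; have lt_x : (index x g < size g)%N by rewrite index_mem.
exists (mkseq (fun k => (k == index x g)%:R) (size g)).
rewrite size_mkseq; split=> //.
rewrite (bigD1 (Ordinal lt_x)) //= nth_mkseq // eqxx mul1r nth_index //.
rewrite big1 ?addr0 // => k; rewrite -val_eqE nth_mkseq //= => /negPf ->.
by rewrite mul0r.
Qed.

End InIdealGen.

(** * The isomorphism with the character ring *)

Theorem theorem3p4 (R : realType) (p1 p2 p3 : nat) (q1 q2 q3 : int)
    (hp1 : (2 <= p1)%N) (hp2 : (2 <= p2)%N) (hp3 : (2 <= p3)%N)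
    (hc1 : coprimez p1%:Z q1) (hc2 : coprimez p2%:Z q2) (hc3 : coprimez p3%:Z q3)
    (A : comAlgType (complex R)) (t : word -> A)
    (hA : is_char_ring p1 p2 p3 q1 q2 q3 t) :
  let phi := mmap (fun c : complex R => c%:A) (fun k : 'I_7 => t (var_word k)) in
  (forall a : A, exists f : {mpoly (complex R)[7]}, phi f = a) /\
  (forall f : {mpoly (complex R)[7]},
      phi f = 0 <-> in_ideal_gen (gens (complex R) p1 p2 p3 q1 q2 q3) f).
Proof.
pose C := complex R; pose P := {mpoly C[7]}.
set G := gens _ _ _ _ _ _ _.
move=> phi0.
pose phi (x : P) : A := mmap (in_alg A) (fun k : 'I_7 => t (var_word k)) x.
rewrite -[phi0]/phi {phi0}.
have phi_linear : linear phi.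
  by move=> c x y; rewrite /phi mmapD mmapZ /= mulr_algl.
have phi_mult : monoid_morphism phi.
  by split=> [|x y]; rewrite /phi ?mmap1 ?rmorph1 // rmorphM.
pose phiL := GRing.isLinear.Build C P A *:%R phi phi_linear.
pose phiM := GRing.isMonoidMorphism.Build P A phi phi_mult.
pose Phi : {lrmorphism P -> A} := HB.pack phi phiL phiM.
have phiX i : Phi 'X_i = t (var_word i)
  by rewrite [LHS](mmapX _ (in_alg A)) mmap1U.
have two_inj (B : comAlgType C) (b : B) : 2 * b = 0 -> b = 0.
  move=> b0; rewrite -[b]scale1r -(@mulVf C 2) ?pnatr_eq0 // -scalerA.
  by rewrite (_ : 2 *: b = 0) ?scaler0 // scaler_nat -[RHS]b0 mulr_natl.
have [tA univ] := hA.
have phi_vars : [/\ Phi (vU C) = t w_h,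
    [/\ Phi (vX C 1) = t w_c1, Phi (vX C 2) = t w_c2 & Phi (vX C 3) = t w_c3] &
    [/\ Phi (vY C 1) = t (w_h ++ w_c1), Phi (vY C 2) = t (w_h ++ w_c2)
      & Phi (vY C 3) = t (w_h ++ w_c3)]].
  by split; [|split|split]; rewrite phiX /var_word /= inordK.
have phi_gens g : g \in G -> Phi g = 0.
  move: g; apply/gens_char_eqs; have := trace_char_eqs tA (@two_inj A).
  by have [<- [<- <- <-] [<- <- <-]] := phi_vars.
have phi_ideal x : in_ideal_gen G x -> Phi x = 0.
  case=> c [_ ->]; rewrite rmorph_sum big1 // => k _.
  by rewrite rmorphM [X in _ * X](phi_gens _ (mem_nth 0 (ltn_ord k))) mulr0.
(* The ideal is proper because [Phi] kills it while 1 <> 0 in A. *)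
have ideal1 : ~ in_ideal_gen G 1.
  by move/phi_ideal; rewrite rmorph1 => /eqP; rewrite oner_eq0.
have [B [pi [pi_surj pi_ker]]] := quotient_algebra (in_ideal_gen0 G)
  (@in_ideal_genD _ G) (@in_ideal_genM _ G) ideal1.
have pi_Phi x : pi x = 0 -> Phi x = 0 by move/pi_ker/phi_ideal.
have [psi psi_pi] := lrmorphism_factor pi_surj pi_Phi.
have pi_gens g : g \in G -> pi g = 0.
  by move=> Gg; apply/pi_ker/in_ideal_gen_mem.
set tau := fun w => otr (pi (vU C)) (pi (vX C 1)) (pi (vX C 2)) (pi (vX C 3))
  (pi (vY C 1)) (pi (vY C 2)) (pi (vY C 3))
  (rho (pi (vU C)) (pi (vX C 1)) (pi (vX C 2)) (pi (vX C 3)) w).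
have tau_trace : trace_fun p1 p2 p3 q1 q2 q3 tau.
  by apply: char_eqs_trace; [exact: two_inj | apply/gens_char_eqs].
(* The generators vanish in B, so its trace form is a trace function and universality gives F : A ->
   B, the inverse of [psi]. *)
have [[F F_t] _] := univ B tau tau_trace.
have tauE w : tau w = pi (generic_trace C w) by exact/esym/rmorph_otr.
have phi_trace w : Phi (generic_trace C w) = t w.
  rewrite [LHS]rmorph_otr [RHS](traceE tA).
  by have [<- [<- <- <-] [<- <- <-]] := phi_vars.
have psi_tau w : psi (tau w) = t w.
  by rewrite tauE; exact: etrans (psi_pi _) (phi_trace w).
have [_ A_ext] := univ A t tA.
(* Uniqueness, applied to A itself: [psi] o F fixes every t w. *)
have psiF a : psi (F a) = a.
  apply: (A_ext (psi \o F) idfun) => w //=.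
  by rewrite F_t psi_tau.
have F_Phi x : F (Phi x) = pi x.
  apply: (mpoly_lrmorphism_ext (f := F \o Phi)) => i.
  apply: (etrans (congr1 F (phiX i))).
  by rewrite F_t tauE generic_trace_var_word.
(* Surjectivity: if F a = pi x, then Phi x = psi (pi x) = psi (F a) = a. The kernel: Phi x = 0
   forces pi x = F (Phi x) = 0. *)
split=> [a|x].
  by have [x pix] := pi_surj (F a); exists x; rewrite -[LHS]psi_pi pix psiF.
split=> [phix|]; last exact: phi_ideal.
by apply/pi_ker; rewrite -F_Phi [Phi x]phix rmorph0.
Qed.
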